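(* For each primitive set $\mathscr{B}\subset\mathbb{N}\setminus\{1\}$, the subshift $(X_{\mathscr{B}},S)$ is transitive if and only if $\mathscr{B}$ is coprime.
   Context: $\mathbb{N}=\{1,2,\ldots\}$. $\mathscr{B}$ is primitive if no element of $\mathscr{B}$ divides a different element of $\mathscr{B}$; $\mathscr{B}$ is coprime if its elements are pairwise coprime. A set $A\subset\mathbb{Z}$ is $\mathscr{B}$-admissible if for every $b\in\mathscr{B}$ it misses at least one residue class modulo $b$; $X_{\mathscr{B}}$ is the set of all $x\in\{0,1\}^{\mathbb{Z}}$ whose support $\{i:x(i)=1\}$ is $\mathscr{B}$-admissible (a closed, shift-invariant set). $S$ is the left shift. A system $(X,T)$ ($T$ a homeomorphism) is transitive if some point has a dense orbit $\{T^nx:n\in\mathbb{Z}\}$; equivalently (for these subshifts) for all nonempty open $U,V\subset X$ there is $n\in\mathbb{Z}$ with $U\cap T^nV\ne\emptyset$. *)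

(* Defs.v *)
From mathcomp Require Import all_boot all_order all_algebra.
From mathcomp Require Import boolp classical_sets functions.
From mathcomp Require Import topology.

Set Implicit Arguments.
Unset Strict Implicit.
Unset Printing Implicit Defensive.

Import GRing.Theory.

Local Open Scope classical_set_scope.

Record homeomorphism (X : topologicalType) := Homeomorphism {
  homeo_fun :> X -> X;
  homeo_inv : X -> X;
  homeo_cts : continuous homeo_fun;
  homeo_inv_cts : continuous homeo_inv;
  homeo_funK : cancel homeo_fun homeo_inv;
  homeo_invK : cancel homeo_inv homeo_fun
}.

Definition iterz (X : topologicalType) (T : homeomorphism X) (n : int)
    (x : X) : X :=
  match n with
  | Posz k => iter k T x
  | Negz k => iter k.+1 (homeo_inv T) x
  end.

Definition orbit (X : topologicalType) (T : homeomorphism X) (x : X) : set X :=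
  range (fun n : int => iterz T n x).

Definition transitive_system (X : topologicalType) (T : homeomorphism X) :
    Prop :=
  exists x : X, dense (orbit T x).

Definition primitive_set (B : set nat) : Prop :=
  forall b c : nat, B b -> B c -> b != c -> ~~ (b %| c)%N.

Definition coprime_set (B : set nat) : Prop :=
  forall b c : nat, B b -> B c -> b != c -> coprime b c.

(* A residue class modulo b is represented by any integer r in it. *)
Definition admissible (B : set nat) (A : set int) : Prop :=
  forall b : nat, B b ->
    exists r : int, forall a : int, A a -> ~ (a = r %[mod b%:Z])%Z.

(* {0,1}^Z with the product of the discrete topologies; 1 is [true]. *)
Definition full_shift : topologicalType :=
  prod_topology (fun _ : int => bool).

Definition support (x : full_shift) : set int := [set i | x i].

Definition admissible_shift (B : set nat) : set full_shift :=
  [set x | admissible B (support x)].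

Definition translate (k : int) (x : full_shift) : full_shift :=
  fun i => x (i + k)%R.

Lemma translate_continuous (k : int) : continuous (translate k).
Proof.
move=> x; apply/cvg_sup => i U [V [[W oW <-] /= Wx /filterS]]; apply.
apply: (@proj_continuous _ (fun _ : int => bool) (i + k)%R x).
exact: open_nbhs_nbhs.
Qed.

Lemma translate_admissible (B : set nat) (k : int) (x : full_shift) :
  admissible_shift B x -> admissible_shift B (translate k x).
Proof.
move=> adx b /adx[r hr]; exists (r - k)%R => a /= /hr nar e; apply: nar.
by rewrite -modzDml e modzDml subrK.
Qed.

(* [set_type A] carries the subspace topology of A. *)
Definition translate_sub (B : set nat) (k : int)
    (x : set_type (admissible_shift B)) : set_type (admissible_shift B) :=
  SigSub (mem_set (translate_admissible k (set_valP x))).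

Lemma translate_sub_continuous (B : set nat) (k : int) :
  continuous (@translate_sub B k).
Proof.
apply: continuous_comp_initial => x.
apply: (@continuous_comp _ _ _ set_val (translate k)).
  exact: (@initial_continuous _ full_shift set_val).
exact: translate_continuous.
Qed.

Lemma translate_subK (B : set nat) (k l : int) :
  (k + l = 0)%R -> cancel (@translate_sub B k) (@translate_sub B l).
Proof.
move=> kl x; apply: val_inj; apply: funext => i /=.
by rewrite /translate -addrA [(l + k)%R]addrC kl addr0.
Qed.

(* The left shift (S x)(i) = x(i + 1) restricted to X_B. *)
Definition left_shift (B : set nat) :
    homeomorphism (set_type (admissible_shift B)) :=
  Homeomorphism
    (@translate_sub_continuous B 1%R) (@translate_sub_continuous B (-1)%R)
    (@translate_subK B 1%R (-1)%R (subrr _))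
    (@translate_subK B (-1)%R 1%R (addNr _)).

(* Main.v *)
(* If B is coprime, finite admissible sets can be glued: for the finitely many
   small b in B the Chinese remainder theorem supplies a translate of the second
   set missing the same residue class mod b as the first, and for the large b the
   union is too small to meet every class.  Gluing an enumeration of all finite
   patterns one after the other yields a point with dense orbit.
   Conversely let b, c in B have gcd d > 1, and let g divide c but not b, with d
   not dividing g (such g exists up to exchanging b and c).  One finite
   admissible set meets every nonzero class mod b and mod c; another meets every
   class other than g mod c, and every class mod b congruent to g mod d, so that
   any n has its class mod b or its class mod c met.  A point y containing a
   translate by n of the first can only miss the classes of n mod b and mod c,
   and a translate of the second meets one of these.  The elements of both sets
   have the form gcd(r, m) * q with m = b or c, and q coprime to all small
   numbers; by primitivity this keeps them away from 0 modulo the rest of B. *)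

Require Import Defs.
From mathcomp Require Import all_boot all_order all_algebra.
From mathcomp Require Import boolp classical_sets functions topology.
From mathcomp Require Import zify ring.

Import Order.TTheory GRing.Theory Num.Theory.

Local Open Scope classical_set_scope.

(** * Residue classes and the Chinese remainder theorem *)

Section Arithmetic.
Local Open Scope ring_scope.

Lemma eqz_modP (a r d : int) : (a = r %[mod d])%Z <-> (d %| a - r)%Z.
Proof. by rewrite -eqz_mod_dvd; split=> /eqP. Qed.

Lemma exists_missed_residue (s : seq int) (b : nat) :
  (size s < b)%N ->
  exists r : int, forall a : int, a \in s -> ~ (a = r %[mod b%:Z])%Z.
Proof.
move=> lt_s_b; apply: contrapT => /forallNP hit.
suff: (size (map Posz (iota 0 b)) <= size (map (fun a => (a %% b)%Z) s))%N.
  by rewrite !size_map size_iota leqNgt lt_s_b.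
apply: uniq_leq_size; first by rewrite map_inj_uniq ?iota_uniq // => i j [].
move=> x /mapP[i]; rewrite mem_iota add0n => /andP[_ lt_i_b] ->.
have /existsNP[a /not_implyP[sa /contrapT e]] := hit i%:Z.
by apply/mapP; exists a => //; rewrite e modz_small //; lia.
Qed.

(** The lower bound [M] later lets a translate be pushed to the right of everything already
    placed. *)
Lemma chinese_seq (l : seq nat) (f : nat -> int) (M : int) :
  uniq l -> {in l, forall b, 0 < b}%N ->
  {in l &, forall b c, b != c -> coprime b c} ->
  exists2 n : int, M <= n & {in l, forall b : nat, (n = f b %[mod b%:Z])%Z}.
Proof.
elim: l => [|b l IHl] /=; first by move=> *; exists M.
move=> /andP[bNl ul] l_gt0 lcop.
have [||n Mn nP] := IHl ul.
- by move=> c lc; apply: l_gt0; rewrite inE lc orbT.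
- by move=> c d lc ld; apply: lcop; rewrite inE ?lc ?ld orbT.
pose P := (\prod_(c <- l) c)%N.
have /coprimezP[[u v] /= uv1] : coprimez b%:Z P%:Z.
  rewrite coprimezE !absz_nat /P big_seq.
  apply: (big_ind (coprime b)) => [|c d bc bd|c lc]; first exact: coprimen1.
    by rewrite coprimeMr bc.
  apply: lcop; rewrite ?inE ?eqxx ?lc ?orbT //.
  by apply: contraNneq bNl => ->.
have b_gt0 : (0 < b)%N by apply: l_gt0; rewrite inE eqxx.
(* The correction is a multiple of [P], so the congruences modulo [l] survive; [v] inverts [P]
   modulo [b], and reducing modulo [b] keeps the correction nonnegative. *)
exists (n + P%:Z * ((v * (f b - n)) %% b)%Z).
  rewrite (le_trans Mn) // lerDl mulr_ge0 // modz_ge0 //; lia.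
move=> c; rewrite inE => /orP[/eqP ->|lc].
  rewrite -modzDmr modzMmr modzDmr; apply/eqz_modP/dvdzP.
  exists (- u * (f b - n)).
  transitivity ((n - f b) * (1 - v * P%:Z)); first by ring.
  by rewrite -uv1; ring.
rewrite -(nP _ lc); apply/eqz_modP; rewrite addrC addKr; apply: dvdz_mulr.
by rewrite dvdzE !absz_nat /P (big_rem _ lc) /= dvdn_mulr.
Qed.

End Arithmetic.

(** * Coprime case: gluing finite admissible sets *)

Section Transitive.
Local Open Scope ring_scope.
Variable B : set nat.
Hypothesis B_gt1 : B `<=` [set b | (1 < b)%N].

Lemma admissible_cat_translate (s t : seq int) (M : int) :
  coprime_set B -> admissible B [set` s] -> admissible B [set` t] ->
  exists2 n : int, M <= n &
    admissible B [set` s ++ [seq a + n | a <- t]].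
Proof.
move=> Bcop ads adt.
have rP (u : seq int) : admissible B [set` u] ->
    {r : nat -> int & forall b, B b ->
      forall a, a \in u -> ~ (a = r b %[mod b%:Z])%Z}.
  move=> adu; apply: (@choice _ _ (fun b r => B b ->
      forall a, a \in u -> ~ (a = r %[mod b%:Z])%Z)) => b.
  by have [/adu[r hr]|NBb] := pselect (B b); [exists r|exists 0].
have [rs rsP] := rP s ads; have [rt rtP] := rP t adt.
pose l := [seq b <- iota 0 (size s + size t).+1 | `[< B b >]].
have lB b : b \in l -> B b by rewrite mem_filter => /andP[/asboolP].
(* Translation by this [n] carries the class missed by [t] to the class missed by [s]. *)
have [|||n Mn nP] := @chinese_seq l (fun b => rs b - rt b) M.
- by rewrite filter_uniq ?iota_uniq.
- by move=> b /lB/B_gt1/ltnW.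
- by move=> b c /lB Bb /lB Bc; apply: Bcop.
exists n => // b Bb.
have [le_b|lt_b] := leqP b (size s + size t); last first.
  by apply: exists_missed_residue; rewrite size_cat size_map.
have {}nP : (n = rs b - rt b %[mod b%:Z])%Z.
  by apply: nP; rewrite mem_filter mem_iota ltnS le_b !andbT; apply/asboolP.
exists (rs b) => a; rewrite /= mem_cat => /orP[sa|/mapP[a' ta' ->]].
  exact: rsP.
rewrite -modzDmr nP modzDmr => /eqz_modP h; apply: (rtP b Bb a' ta').
apply/eqz_modP; congr (_ %| _)%Z: h; ring.
Qed.

Definition centered (N : nat) (t : seq int) := {in t, forall a, `|a| <= N%:Z}.

(** Points are added only to the right of [M], so that patterns placed earlier stay intact. A [t]
    that is not admissible or not centered is skipped by keeping [s]. *)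
Lemma exists_extension (s t : seq int) (M : int) (N : nat) :
  coprime_set B -> admissible B [set` s] -> {in s, forall a, a <= M} ->
  exists s' : seq int, exists M' : int,
   [/\ admissible B [set` s'], {in s', forall a, a <= M'}, M <= M',
       forall a, a <= M -> (a \in s') = (a \in s) &
       admissible B [set` t] -> centered N t ->
       exists n, forall i, `|i| <= N%:Z ->
         i + n <= M' /\ (i + n \in s') = (i \in t)].
Proof.
move=> Bcop ads sM.
have [[adt tN]|Nt] := pselect (admissible B [set` t] /\ centered N t);
  last first.
  by exists s, M; split=> // adt tN; case: Nt.
(* With this bound the window of radius [N] around [n] lies strictly to the right of [M]. *)
have [n Mn adn] := admissible_cat_translate s t (`|M| + N%:Z + 1) Bcop ads adt.
exists (s ++ [seq a + n | a <- t]), (n + N%:Z); split=> //.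
- move=> a; rewrite mem_cat => /orP[/sM|/mapP[i /tN iN ->]]; lia.
- lia.
- move=> a aM; rewrite mem_cat orbC; case: mapP => // -[i /tN iN e]; lia.
- move=> _ _; exists n => i iN; split; first lia.
  have <- : (i + n \in [seq a + n | a <- t]) = (i \in t).
    exact/mem_map/addIr.
  rewrite mem_cat.
  by case: (boolP (_ \in s)) => // /sM; lia.
Qed.

Definition window (N : nat) : seq int :=
  [seq k%:Z - N%:Z | k <- iota 0 (2 * N).+1].

Lemma mem_window N (i : int) : (i \in window N) = (`|i| <= N%:Z).
Proof.
apply/mapP/idP => [[k]|iN]; first by rewrite mem_iota => kN ->; lia.
by exists (absz (i + N%:Z)); rewrite ?mem_iota; lia.
Qed.

Lemma admissible_sub (A A' : set int) :
  A `<=` A' -> admissible B A' -> admissible B A.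
Proof. by move=> sAA' adA b /adA[r hr]; exists r => a /sAA'; apply: hr. Qed.

(* The classes mod b missed by the S k form a decreasing sequence of nonempty
   finite sets. *)
Lemma admissible_bigcup (S : nat -> seq int) :
  (forall k m, (k <= m)%N -> {subset S k <= S m}) ->
  (forall k, admissible B [set` S k]) ->
  admissible B (\bigcup_k [set` S k]).
Proof.
move=> S_mono adS b Bb; apply: contrapT => /forallNP hit.
have {hit}/choice[k kP] (r : nat) :
    exists k, exists2 a, a \in S k & (a = r%:Z %[mod b%:Z])%Z.
  have /existsNP[a /not_implyP[[k _ Sa] /contrapT e]] := hit r%:Z.
  by exists k, a.
(* [S K] already meets every class modulo [b]. *)
pose K := (\max_(r < b) k r)%N.
have [r hr] := adS K b Bb.
have b_gt0 : (0 < b)%N by exact/ltnW/B_gt1.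
have bP : b%:Z != 0 by lia.
have rb := @ltz_pmod r b%:Z b_gt0; have r0 := modz_ge0 r bP.
have rK : (absz (r %% b)%Z < b)%N by lia.
have [a Sa e] := kP (absz (r %% b)%Z).
apply: (hr a); first exact: S_mono (leq_bigmax (Ordinal rK)) _ Sa.
by rewrite e gez0_abs // modz_mod.
Qed.

(** Combinatorial form of a dense orbit; see [dense_orbitP]. *)
Definition pattern_rich (y : int -> bool) := forall x N, admissible_shift B x ->
  exists n : int, forall i : int, `|i| <= N%:Z -> y (i + n) = x i.

Lemma exists_pattern_rich :
  coprime_set B -> exists2 y, admissible_shift B y & pattern_rich y.
Proof.
move=> Bcop.
(* A stage (s, M) of the construction fixes the point on the half-line
   i <= M. *)
pose good (p : seq int * int) :=
  admissible B [set` p.1] /\ {in p.1, forall a, a <= p.2}.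
pose step (kp : nat * {p | good p}) (q : {p | good p}) :=
  let: (s, M) := sval kp.2 in let: (s', M') := sval q in
  [/\ M <= M', forall a, a <= M -> (a \in s') = (a \in s) &
   forall (N : nat) (t : seq int), unpickle kp.1 = Some (N, t) ->
   admissible B [set` t] -> centered N t ->
       exists n, forall i, `|i| <= N%:Z ->
         i + n <= M' /\ (i + n \in s') = (i \in t)].
have /choice[f fP] : forall kp, exists q, step kp q.
  move=> [k [[s M] [/= ads sM]]].
  (* Stage [k] places the pattern coded by [k]; the default is arbitrary, since a [k] that codes
     nothing imposes no condition. *)
  pose Nt : nat * seq int := odflt (0%N, [::]) (unpickle k).
  have [s' [M' [ads' sM' MM' s's s't]]] :=
    exists_extension s Nt.2 M Nt.1 Bcop ads sM.
  exists (exist good (s', M') (conj ads' sM')); split=> //= N t kE.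
  by move: s't; rewrite /Nt kE.
have good0 : good ([::], 0).
  by split=> // b Bb; exists 0.
pose st := fix st k := if k is k'.+1 then f (k', st k') else exist good _ good0.
pose S k := (sval (st k)).1; pose M k := (sval (st k)).2.
have [adS SM] : (forall k, admissible B [set` S k]) /\
    (forall k, {in S k, forall a, a <= M k}).
  by split=> k; rewrite /S /M; case: (sval (st k)) (svalP (st k)) => ? ? [].
have stepP k : [/\ M k <= M k.+1,
   forall a, a <= M k -> (a \in S k.+1) = (a \in S k) &
   forall (N : nat) (t : seq int), unpickle k = Some (N, t) ->
   admissible B [set` t] -> centered N t ->
       exists n, forall i, `|i| <= N%:Z ->
         i + n <= M k.+1 /\ (i + n \in S k.+1) = (i \in t)].
  have := fP (k, st k); rewrite /step /S /M /=.
  by case: (sval (st k)) => ? ?; case: (sval (f _)).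
have stable k m : (k <= m)%N -> M k <= M m /\
    forall a, a <= M k -> (a \in S m) = (a \in S k).
  move=> /subnK <-; elim: (m - k)%N => [//|j [Mj Sj]]; rewrite addSn.
  have [Mj' Sj' _] := stepP (j + k)%N.
  split=> [|a ak]; first exact: le_trans Mj'.
  by rewrite Sj' ?Sj // (le_trans ak).
pose y i := `[< (\bigcup_k [set` S k]) i >].
have yE k i : i <= M k -> y i = (i \in S k).
  move=> iM; apply/asboolP/idP => [[m _ /= Sm]|Sk]; last by exists k.
  have [/stable[_ <-]//|/ltnW/stable[_ e]] := leqP k m.
  by rewrite e //; exact: SM.
exists y.
  rewrite /admissible_shift /support /=.
  apply: (@admissible_sub _ (\bigcup_k [set` S k])) => [i /asboolP//|].
  apply: admissible_bigcup => // k m km a Sa.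
  by have [_ ->] := stable k m km; rewrite ?SM.
move=> x N adx; pose t := [seq i <- window N | x i].
have tE i : `|i| <= N%:Z -> (i \in t) = x i.
  by move=> iN; rewrite mem_filter mem_window iN andbT.
have [_ _ /(_ N t (pickleK _))[]] := stepP (pickle (N, t)).
- by apply: admissible_sub adx => i /=; rewrite mem_filter => /andP[].
- by move=> i; rewrite mem_filter mem_window => /andP[].
by move=> n nP; exists n => i iN; have [/yE -> ->] := nP i iN; exact: tE.
Qed.

End Transitive.

(** * Dense orbits in terms of finite patterns *)

Section Topology.
Local Open Scope ring_scope.
Variable B : set nat.

Lemma iterz_left_shift (n : int) (x : set_type (admissible_shift B)) (i : int) :
  val (iterz (left_shift B) n x) i = val x (i + n).
Proof.
have iterE k l j : val (iter k (@translate_sub B l) x) j = val x (j + l *+ k).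
  elim: k j => [|k IHk] j; first by rewrite mulr0n addr0.
  by rewrite iterS /= /translate IHk mulrS addrA.
case: n => k; first by rewrite [LHS]iterE natz.
by rewrite [LHS]iterE NegzE mulNrn natz.
Qed.

Lemma open_cylinder (x : full_shift) (w : seq int) :
  open [set z : full_shift | all (fun i => z i == x i) w].
Proof.
elim: w => [|i w IHw].
  rewrite [X in open X](_ : _ = setT); first exact: openT.
  by apply/seteqP; split.
rewrite [X in open X](_ : _ =
    (fun z : full_shift => z i) @^-1` [set x i] `&`
    [set z : full_shift | all (fun i => z i == x i) w]).
  apply: openI => //; apply: open_comp; last exact: discrete_open.
  by move=> z _; exact: (@proj_continuous _ (fun _ : int => bool) i z).
apply/seteqP; split=> z /=; first by move=> /andP[/eqP].
by move=> [/eqP zi zw]; apply/andP.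
Qed.

Lemma open_contains_cylinder (O : set full_shift) (x : full_shift) :
  open O -> O x ->
  exists N : nat,
    [set z : full_shift | forall i, `|i| <= N%:Z -> z i = x i] `<=` O.
Proof.
move=> oO Ox.
(* The filter generated by the centered cylinders at [x] converges to [x], because it does so in
   each coordinate; hence [O] contains one of them. *)
pose F := filter_from setT
  (fun N : nat => [set z : full_shift | forall i, `|i| <= N%:Z -> z i = x i]).
have FF : Filter F.
  apply: filter_from_filter; first by exists 0%N.
  move=> N M _ _; exists (maxn N M) => // z zP; split=> i iN; apply: zP; lia.
have Fx : F --> x.
  apply/cvg_sup => i U [V [[W oW <-] /= Wx /filterS]]; apply.
  by exists (absz i) => // z /= zP; rewrite zP //; lia.
by have [N _ NO] := Fx O (open_nbhs_nbhs (conj oO Ox)); exists N.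
Qed.

Lemma dense_orbitP (y : set_type (admissible_shift B)) :
  dense (Defs.orbit (left_shift B) y) <-> pattern_rich B (val y).
Proof.
split=> [dy x N adx|rich O [x Ox] [O' oO' OE]].
  pose x' : set_type (admissible_shift B) := SigSub (mem_set adx).
  have [||z [/allP /= zP [n _ zE]]] :=
      dy (set_val @^-1`
        [set z : full_shift | all (fun i => z i == x i) (window N)]).
  - by exists x'; apply/allP.
  - apply: open_comp; last exact: open_cylinder.
    by move=> z _; exact: (@initial_continuous _ full_shift set_val).
  exists n => i; rewrite -mem_window => /zP/eqP <-.
  by rewrite -zE -iterz_left_shift.
rewrite -OE in Ox.
have [N NO'] := open_contains_cylinder _ _ oO' Ox.
have [n nP] := rich _ N (set_valP x).
exists (iterz (left_shift B) n y); split; last by exists n.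
by rewrite -OE; apply: NO' => i iN; rewrite [LHS]iterz_left_shift nP.
Qed.

End Topology.

(** * Non-coprime case: two finite patterns that cannot occur in one point *)

Section NotTransitive.

(** An elementary substitute for Dirichlet's theorem: [q] need not be prime, only avoid the primes
    dividing [N]. *)
Lemma coprime_factor_in_progression (r m N : nat) :
  0 < r -> 0 < N ->
  exists k q, r + m * k = gcdn r m * q /\ coprime q N.
Proof.
move=> r_gt0 N_gt0; pose g := gcdn r m.
have g_gt0 : 0 < g by rewrite gcdn_gt0 r_gt0.
pose r' := r %/ g; pose m' := m %/ g.
have rE : r = g * r' by rewrite mulnC divnK ?dvdn_gcdl.
have mE : m = g * m' by rewrite mulnC divnK ?dvdn_gcdr.
have r'_gt0 : 0 < r' by move: r_gt0; rewrite rE muln_gt0 => /andP[].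
have cop : coprime r' m'.
  by rewrite /coprime -(eqn_pmul2l g_gt0) muln_gcdr -rE -mE muln1.
(* The primes dividing N split between r' and k, and none divides both. *)
pose k := N`_(negn \pi(r')); exists k, (r' + m' * k).
split; first by rewrite mulnDr mulnA -rE -mE.
rewrite coprime_sym coprime_has_primes ?addn_gt0 ?r'_gt0 //.
apply/hasPn => p; rewrite !mem_primes => /and3P[p_pr _ p_dvd].
rewrite N_gt0 p_pr /=; apply/negP => pN.
have [pr'|pr'] := boolP (p %| r').
  have : p %| m' * k by rewrite -(dvdn_addr _ pr').
  rewrite Euclid_dvdM // => /orP[pm'|pk].
    have : p %| gcdn r' m' by rewrite dvdn_gcd pr'.
    by rewrite (eqP cop) dvdn1 => /eqP p1; rewrite p1 in p_pr.
  have /pnatP := part_pnat (negn \pi(r')) N => /(_ (part_gt0 _ _) p p_pr pk).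
  by rewrite !inE mem_primes r'_gt0 p_pr pr'.
have pk : p %| k.
  rewrite -(@part_pnat_id (negn \pi(r')) p) ?partn_dvd // pnatE //.
  by rewrite !inE mem_primes (negPf pr') !andbF.
by case/negP: pr'; rewrite -(dvdn_addl r' (dvdn_mull m' pk)).
Qed.

(* g is the p-part of c or of b for a suitable prime p. *)
Lemma exists_separating_divisor (b c : nat) :
  0 < b -> 0 < c -> ~~ (b %| c) -> ~~ (c %| b) -> ~~ coprime b c ->
  (exists g, [/\ g %| c, ~~ (g %| b) & ~~ (gcdn b c %| g)]) \/
  (exists g, [/\ g %| b, ~~ (g %| c) & ~~ (gcdn b c %| g)]).
Proof.
move=> b_gt0 c_gt0 bc cb Ncop.
have ppart m n : 0 < m -> ~~ (m %| n) -> exists p : nat, ~~ (m`_p %| n).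
  move=> m_gt0; apply: contraNP => /forallNP h; apply/dvdn_partP => // p _.
  exact/negPn/negP/h.
have [p cpb] := ppart c b c_gt0 cb; have [q bqc] := ppart b c b_gt0 bc.
have [dp|dp] := boolP (gcdn b c %| c`_p); last first.
  by left; exists c`_p; rewrite dvdn_part.
have [dq|dq] := boolP (gcdn b c %| b`_q); last first.
  by right; exists b`_q; rewrite dvdn_part.
(* The gcd now divides the [p]-part of [c] and the [q]-part of [b]. If [p = q], one of these parts
   divides the other, against the choice of [p] or [q]; otherwise they are coprime and the gcd is
   1. *)
have [epq|npq] := eqVneq p q.
  rewrite -{q}epq in bqc dq.
  have [le|/ltnW le] := leqP (logn p b) (logn p c).
    case/negP: bqc; apply: dvdn_trans (dvdn_part p c).
    by rewrite !p_part dvdn_exp2l.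
  case/negP: cpb; apply: dvdn_trans (dvdn_part p b).
  by rewrite !p_part dvdn_exp2l.
case/negP: Ncop; rewrite /coprime -dvdn1.
have /eqP <- : coprime c`_p b`_q.
  apply: pnat_coprime (part_pnat p c) _.
  apply: sub_in_pnat (part_pnat q b) => r _ /eqnP ->.
  by rewrite !inE eq_sym.
by rewrite dvdn_gcd dp.
Qed.

(** A pair [(r, m)] stands for the class of [r] modulo [m]. Its representative is [gcdn r m] times a
    number coprime to the factorial of [L], so its divisors up to [L] divide [gcdn r m]. *)
Lemma exists_hitting_set (T : seq (nat * nat)) (L : nat) :
  {in T, forall p, 0 < p.1} ->
  exists s : seq int,
  [/\ size s = size T,
   {in T, forall p, exists2 a, a \in s & (a = p.1%:Z %[mod p.2%:Z])%Z} &
   {in s, forall a, exists2 p, p \in T & (a = p.1%:Z %[mod p.2%:Z])%Z /\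
     forall e, 0 < e <= L -> (e%:Z %| a)%Z -> (e %| p.1) && (e %| p.2)}].
Proof.
move=> T_gt0.
have /choice[f fP] (p : nat * nat) : exists x : nat, p \in T ->
    (x = p.1 %[mod p.2]) /\
    forall e, 0 < e <= L -> e %| x -> (e %| p.1) && (e %| p.2).
  have [/T_gt0 p_gt0|_] := boolP (p \in T); last by exists 0.
  have [k [q [xE copq]]] :=
    coprime_factor_in_progression p.1 p.2 L`! p_gt0 (fact_gt0 L).
  exists (p.1 + p.2 * k) => _; split=> [|e eL].
    by rewrite mulnC addnC modnMDl.
  rewrite xE Gauss_dvdl ?dvdn_gcd // coprime_sym.
  exact: coprime_dvdr (dvdn_fact eL) copq.
exists [seq Posz (f p) | p <- T]; split; first by rewrite size_map.
  move=> p pT; exists (Posz (f p)); first exact: map_f.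
  by have [e _] := fP p pT; rewrite !modz_nat e.
move=> a /mapP[p pT ->]; exists p => //.
by have [e h] := fP p pT; rewrite !modz_nat e.
Qed.

(* Representatives in [1, b]: exists_hitting_set excludes the residue 0. *)
Lemma exists_residue_rep (b : nat) (w : int) : 0 < b ->
  exists2 r : nat, r \in iota 1 b & (r%:Z = w %[mod b%:Z])%Z.
Proof.
move=> b_gt0; exists (absz ((w - 1) %% b%:Z)%Z).+1.
  have := @modz_ge0 (w - 1)%R b; have := @ltz_pmod (w - 1)%R b b_gt0.
  rewrite mem_iota; lia.
have bN0 : Posz b != 0%R by lia.
by rewrite -addn1 PoszD gez0_abs ?modz_ge0 // modzDml subrK.
Qed.

Section Obstruction.
Variables (B : set nat) (b c g : nat).
Hypothesis B_gt1 : B `<=` [set b | 1 < b].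
Hypothesis B_prim : primitive_set B.
Hypotheses (Bb : B b) (Bc : B c).

Let b_gt0 : 0 < b. Proof. exact/ltnW/B_gt1. Qed.
Let c_gt0 : 0 < c. Proof. exact/ltnW/B_gt1. Qed.

Lemma primitive_dvd_eq (e e' : nat) : B e -> B e' -> e %| e' -> e = e'.
Proof.
by move=> Be Be' ee'; apply: contraTeq ee' => ne; apply: B_prim.
Qed.

(** At most [b + c] points are used, so a class is missed modulo any larger [e] in [B]. For smaller
    [e] the class 0 is missed: a point divisible by [e] represents some [(r, m)] with [e] dividing
    [r] and [m], so [e = m] by primitivity, but [m] does not divide [r]. *)
Lemma exists_hit_nonzero :
  exists2 s : seq int, admissible B [set` s] &
  forall m, m = b \/ m = c -> forall v : int, ~~ (m%:Z %| v)%Z ->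
    exists2 a, a \in s & (a = v %[mod m%:Z])%Z.
Proof.
pose nz m := [seq (r, m) | r <- [seq r <- iota 1 m | ~~ (m %| r)]].
have mem_nz m p : p \in nz m -> [/\ 0 < p.1, p.2 = m & ~~ (m %| p.1)].
  by move=> /mapP[r]; rewrite mem_filter mem_iota => /and3P[? ? _] ->.
pose T := nz b ++ nz c.
have size_nz m : size (nz m) <= m.
  by rewrite size_map size_filter (leq_trans (count_size _ _)) ?size_iota.
have [|s [ss hit sP]] := exists_hitting_set T (b + c).
  by move=> p; rewrite mem_cat => /orP[] /mem_nz[].
exists s => [e Be|m mbc v mv].
  have [le_e|lt_e] := leqP e (b + c); last first.
    apply: exists_missed_residue; apply: leq_ltn_trans lt_e.
    by rewrite ss size_cat leq_add.
  exists 0%R => a /sP[p pT [_ pe]] /eqz_modP; rewrite subr0 => ea.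
  have /andP[e1 e2] : (e %| p.1) && (e %| p.2).
    by apply: pe; rewrite ?le_e ?andbT //; apply/ltnW/B_gt1.
  have [m Bm [_ pm /negP[]]] :
      exists2 m, B m & [/\ 0 < p.1, p.2 = m & ~~ (m %| p.1)].
    by move: pT; rewrite mem_cat => /orP[] /mem_nz; [exists b|exists c].
  by rewrite -(primitive_dvd_eq e m) // -pm.
have m_gt0 : 0 < m by case: mbc => ->.
have [r ri rv] := exists_residue_rep m v m_gt0.
have [|a sa av] := hit (r, m); last by exists a; rewrite // av.
have : (r, m) \in nz m.
  apply: map_f; rewrite mem_filter ri andbT.
  apply: contra mv => mr; rewrite -[v](subrK (Posz r)) rpredD //.
  by apply/eqz_modP.
by rewrite mem_cat; case: mbc => ->  ->; rewrite ?orbT.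
Qed.

Hypotheses (gc : g %| c) (gNb : ~~ (g %| b)) (dNg : ~~ (gcdn b c %| g)).

Lemma exists_hit_either :
  exists2 s : seq int, admissible B [set` s] &
  forall w : int, exists2 m, m = b \/ m = c &
    exists2 a, a \in s & (a = w %[mod m%:Z])%Z.
Proof.
have g_gt0 : 0 < g by exact: dvdn_gt0 gc.
pose d := gcdn b c.
pose Tb := [seq (r, b) | r <- [seq r <- iota 1 b | r == g %[mod d]]].
pose Tc := [seq (r, c) | r <- [seq r <- iota 1 c | r != g %[mod c]]].
have TbP p : p \in Tb -> [/\ 0 < p.1, p.2 = b & p.1 = g %[mod d]].
  by move=> /mapP[r]; rewrite mem_filter mem_iota => /and3P[/eqP ? ? _] ->.
have TcP p : p \in Tc -> [/\ 0 < p.1, p.2 = c & p.1 <> g %[mod c]].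
  by move=> /mapP[r]; rewrite mem_filter mem_iota => /and3P[/eqP ? ? _] ->.
have [|s [ss hit sP]] := exists_hitting_set (Tb ++ Tc) (b + c).
  by move=> p; rewrite mem_cat => /orP[/TbP[]|/TcP[]].
exists s => [e Be|w].
  have [le_e|lt_e] := leqP e (b + c); last first.
    apply: exists_missed_residue; apply: leq_ltn_trans lt_e.
    by rewrite ss size_cat !size_map !size_filter leq_add //
      (leq_trans (count_size _ _)) ?size_iota.
  have e_gt0 : 0 < e by apply/ltnW/B_gt1.
  (* The missed class is g for e = c, and 0 for any other e. *)
  have [->|ec] := eqVneq e c.
    exists (Posz g) => a /sP[p pT [ap pe]] ag.
    move: pT; rewrite mem_cat => /orP[/TbP[_ pb _]|/TcP[_ pc]]; last first.
      case; apply/eqP; rewrite -eqz_nat -!modz_nat -ag -pc; exact/eqP.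
    (* Since [g] divides [c], it divides [a], and so also the modulus [b] of the pair. *)
    case/negP: gNb; rewrite -pb.
    have /andP[] // : (g %| p.1) && (g %| p.2).
    apply: pe; first by rewrite g_gt0 (leq_trans (dvdn_leq _ gc)) // leq_addl.
    rewrite -[a](subrK (Posz g)) rpredD //.
    by apply: (@dvdz_trans c); [exact: gc|exact/eqz_modP].
  exists 0%R => a /sP[p pT [_ pe]] /eqz_modP; rewrite subr0 => ea.
  have /andP[e1 e2] : (e %| p.1) && (e %| p.2).
    by apply: pe; rewrite ?le_e ?andbT.
  move: pT; rewrite mem_cat => /orP[/TbP[_ pb pg]|/TcP[_ pc _]]; last first.
    by rewrite (primitive_dvd_eq e c) ?eqxx // -pc in ec.
  (* Primitivity gives [e = b]; then [d] divides [p.1], which is congruent to [g] modulo [d]. *)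
  case/negP: dNg; rewrite -/d /dvdn -pg -/(dvdn d p.1).
  by apply: dvdn_trans e1; rewrite (primitive_dvd_eq e b) ?dvdn_gcdl // -pb.
have [s' s'i s'w] := exists_residue_rep c w c_gt0.
(* If [w] is congruent to [g] modulo [c], it is so modulo [d], and its class modulo [b] is among
   those in [Tb]; otherwise its class modulo [c] is in [Tc]. *)
have [s'g|s'g] := eqVneq (s' %% c) (g %% c).
  have [r ri rw] := exists_residue_rep b w b_gt0.
  have [|a sa av] := hit (r, b).
    rewrite mem_cat; apply/orP; left; apply: map_f.
    rewrite mem_filter ri andbT.
    have rd : (r = s' %[mod d])%N.
      apply/eqP; rewrite -eqz_nat -!modz_nat eqz_mod_dvd.
      have -> : (r%:Z - s'%:Z = (r%:Z - w) - (s'%:Z - w))%R by ring.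
      rewrite rpredB //.
        apply: (@dvdz_trans b); first exact: dvdn_gcdl.
        exact/eqz_modP.
      apply: (@dvdz_trans c); first exact: dvdn_gcdr.
      exact/eqz_modP.
    by rewrite rd -(modn_dvdm s' (dvdn_gcdr b c)) s'g modn_dvdm ?dvdn_gcdr.
  by exists b; [left|exists a; rewrite // av].
have [|a sa av] := hit (s', c).
  by rewrite mem_cat; apply/orP; right; apply: map_f; rewrite mem_filter s'g.
by exists c; [right|exists a; rewrite // av].
Qed.

Lemma pattern_rich_obstruction (y : int -> bool) :
  admissible_shift B y -> ~ pattern_rich B y.
Proof.
move=> ady rich.
have occurs (s : seq int) : admissible B [set` s] ->
    exists n : int, forall a, a \in s -> y (a + n)%R.
  move=> ads; pose x : int -> bool := fun i => i \in s.
  pose N := (\max_(a <- s) absz a)%N.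
  have [n nP] := rich x N ads; exists n => a sa.
  have aN : absz a <= N by exact: leq_bigmax_seq.
  by rewrite nP //; lia.
have [s1 ad1 hit1] := exists_hit_nonzero.
have [s2 ad2 hit2] := exists_hit_either.
have [n1 y1] := occurs s1 ad1; have [n2 y2] := occurs s2 ad2.
(* The shift [n1 - n2] makes [a + n2] lie in the class of [n1] modulo [m], the only class modulo [m]
   that [s1] translated by [n1] may leave unmet. *)
have [m mbc [a sa am]] := hit2 (n1 - n2)%R.
have Bm : B m by case: mbc => ->.
have [r rP] := ady m Bm.
have [mr|mr] := boolP (m%:Z %| (r - n1)%R)%Z.
  apply: (rP _ (y2 a sa)); apply/eqz_modP.
  have -> : (a + n2 - r = (a - (n1 - n2)) - (r - n1))%R by ring.
  by rewrite rpredB //; apply/eqz_modP.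
have [a' sa' am'] := hit1 m mbc _ mr.
apply: (rP _ (y1 a' sa')); apply/eqz_modP.
have -> : (a' + n1 - r = a' - (r - n1))%R by ring.
exact/eqz_modP.
Qed.

End Obstruction.

End NotTransitive.

Theorem theorem1p4 (B : set nat) (hB : B `<=` [set b | (1 < b)%N])
    (hprim : primitive_set B) :
  transitive_system (left_shift B) <-> coprime_set B.
Proof.
split=> [[y /dense_orbitP rich] b c Bb Bc bNc|Bcop].
  apply/negPn/negP => Ncop.
  have [b_gt0 c_gt0] := (ltnW (hB b Bb), ltnW (hB c Bc)).
  have cNb : c != b by rewrite eq_sym.
  have := exists_separating_divisor b c b_gt0 c_gt0 (hprim b c Bb Bc bNc)
    (hprim c b Bc Bb cNb) Ncop.
  case=> -[g [gc gNb dNg]].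
    exact: (@pattern_rich_obstruction B b c g) (set_valP y) rich.
  rewrite gcdnC in dNg.
  exact: (@pattern_rich_obstruction B c b g) (set_valP y) rich.
have [y ady rich] := exists_pattern_rich B hB Bcop.
by exists (SigSub (mem_set ady)); apply/dense_orbitP.
Qed.
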